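(* Let $\gamma>0$, $G=(-\gamma,\gamma)$, $I=[0,T]$, and let $X$ be a solution on $I$ of the one-dimensional-state SDE $dX(t)=a(t,X(t))\,dt+b(t,X(t))\star dW(t)$ with state space $G$, having a smooth probability density $\rho=\rho(t,x)$ on $[0,T]\times[-\gamma,\gamma]$ (that is, $\rho(t,\cdot)$ is the density of $X(t)$). Let $L\in\mathbb N$. For every $t,t+\Delta t\in I$ with $\Delta t>0$, put $\pi=\rho(t,\cdot)$, $\Psi=\rho(t+\Delta t,\cdot)$, $\mathbf m_L=\mathcal R_L\Psi$, and assume that $\varphi_2(\mathbf m_L,\pi)\ge0$. Then for every $g\in C([-\gamma,\gamma])$ we have $$\big|\mathbb E\,g\big(\varphi_2(\mathbf m_L,X(t))\big)-\mathbb E\,g\big(X(t+\Delta t)\big)\big|\le\frac{C}{L+1}\,\Delta t,$$ with $C$ depending only on $g$, $\rho$, $T$ and $\gamma$.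
   Context: $\star\,dW$ denotes the Itô or Stratonovich differential with respect to a Wiener process $W$; $a,b$ are the drift and dispersion coefficients on $[0,T]\times G$. The moment functions are the monomials $R_l(x)=x^l$, and $\mathcal R_L\phi=\big(\int_{-\gamma}^{\gamma}x^l\phi(x)\,dx\big)_{l=1}^{L}$. For a density $\pi\in L^2(-\gamma,\gamma)$ and $\mathbf m=\mathcal R_L\Psi$ with $\Psi\in L^2(-\gamma,\gamma)$ a probability density, $\varphi_2(\mathbf m,\pi)$ is the unique minimiser of $\tfrac12\|\varphi-\pi\|_{L^2}^2$ over all $\varphi\in L^2(-\gamma,\gamma)$ with $\int_{-\gamma}^{\gamma}\varphi\,dx=1$ and $\mathcal R_L\varphi=\mathbf m$. When $\varphi_2(\mathbf m_L,\pi)\ge0$ it is a probability density, and $\varphi_2(\mathbf m_L,X(t))$ denotes any random variable with this density, so $\mathbb E\,g(\varphi_2(\mathbf m_L,X(t)))=\int_{-\gamma}^{\gamma}g(y)\,\varphi_2(\mathbf m_L,\pi)(y)\,dy$. *)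

(* Defs.v *)
From HB Require Import structures.
From mathcomp Require Import all_boot all_order all_algebra.
From mathcomp Require Import all_classical all_reals all_analysis.
Set Implicit Arguments.
Unset Strict Implicit.
Unset Printing Implicit Defensive.
Import Order.TTheory GRing.Theory Num.Theory.
Import numFieldNormedType.Exports.
Local Open Scope classical_set_scope.
Local Open Scope ring_scope.

(* Functions on (-gamma, gamma) are represented by functions on R whose values
   outside the interval are irrelevant; [f \_ `]-gamma, gamma[ ] is the
   extension by zero. *)
Definition L2fun (R : realType) (gamma : R) (f : R -> R) : Prop :=
  (f \_ `]- gamma, gamma[) \in Lfun (@lebesgue_measure R) 2%:E.

Definition L2norm (R : realType) (gamma : R) (f : R -> R) : \bar R :=
  'N[@lebesgue_measure R]_2%:E[EFin \o (f \_ `]- gamma, gamma[)].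

(* Component [l] of the row is the moment of order [l.+1]. *)
Definition moments (R : realType) (gamma : R) (L : nat) (f : R -> R) :
    'rV[R]_L :=
  \row_(l < L)
    (\int[@lebesgue_measure R]_(x in `]- gamma, gamma[) (x ^+ l.+1 * f x)).

Definition matching_feasible (R : realType) (gamma : R) (L : nat)
    (m : 'rV[R]_L) (f : R -> R) : Prop :=
  [/\ L2fun gamma f,
      \int[@lebesgue_measure R]_(x in `]- gamma, gamma[) f x = 1 &
      moments gamma L f = m].

(* [phi] is a representative of the L^2-class of the minimiser. *)
Definition is_phi2 (R : realType) (gamma : R) (L : nat)
    (m : 'rV[R]_L) (prior phi : R -> R) : Prop :=
  matching_feasible gamma m phi /\
  forall f : R -> R, matching_feasible gamma m f ->
    ((2^-1)%:E * L2norm gamma (phi \- prior)%R ^+ 2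
       <= (2^-1)%:E * L2norm gamma (f \- prior)%R ^+ 2)%E.

(* Smoothness up to the boundary: [D i j] stands for the partial derivative of
   order [i] in time and [j] in space; all of them exist in the interior and
   extend continuously to the closed rectangle. *)
Definition smooth_on_rectangle (R : realType) (T gamma : R)
    (rho : R -> R -> R) : Prop :=
  exists D : nat -> nat -> R -> R -> R,
    [/\ forall t x : R, t \in `[0, T] -> x \in `[- gamma, gamma] ->
          D 0%N 0%N t x = rho t x,
        forall i j, {within `[0, T] `*` `[- gamma, gamma],
          continuous (fun p : R * R => D i j p.1 p.2)},
        forall i j (t x : R), t \in `]0, T[ -> x \in `]- gamma, gamma[ ->
          is_derive t 1 (fun s => D i j s x) (D i.+1 j t x) &
        forall i j (t x : R), t \in `]0, T[ -> x \in `]- gamma, gamma[ ->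
          is_derive x 1 (fun y => D i j t y) (D i j.+1 t x)].

Definition has_density (R : realType) (gamma : R) (d : measure_display)
    (Omega : measurableType d) (P : probability Omega R)
    (Y : {RV P >-> R}) (f : R -> R) : Prop :=
  [/\ forall w, Y w \in `]- gamma, gamma[,
      measurable_fun `]- gamma, gamma[ f,
      {ae @lebesgue_measure R, forall x : R, x \in `]- gamma, gamma[ -> 0 <= f x} &
      forall A : set R, measurable A ->
        distribution P Y A =
        (\int[@lebesgue_measure R]_(x in A `&` `](- gamma)%R, gamma[)
          (f x)%:E)%E].

(* Convergence to 0 in probability. The measurable cover [B] makes this
   meaningful although the events [e < Y n] need only be measurable up to a null
   set, the space not being assumed complete. *)
Definition cvg0_in_prob (R : realType) (d : measure_display)
    (Omega : measurableType d) (P : probability Omega R)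
    (Y : nat -> Omega -> \bar R) : Prop :=
  forall e delta : R, 0 < e -> 0 < delta ->
    \forall n \near \oo, exists B : set Omega,
      [/\ measurable B, [set w | (e%:E < Y n w)%E] `<=` B &
          (P B <= delta%:E)%E].

Definition filtration (R : realType) (d : measure_display)
    (Omega : measurableType d) (T : R) (F : R -> set (set Omega)) : Prop :=
  [/\ forall t : R, t \in `[0, T] -> sigma_algebra setT (F t),
      forall t : R, t \in `[0, T] -> F t `<=` measurable &
      forall s t, 0 <= s -> s <= t -> t <= T -> F s `<=` F t].

Definition measurable_wrt (R : realType) (Omega : Type)
    (G : set (set Omega)) (xi : Omega -> R) : Prop :=
  forall B : set R, measurable B -> G (xi @^-1` B).

Definition adapted (R : realType) (Omega : Type) (T : R)
    (F : R -> set (set Omega)) (Y : R -> Omega -> R) : Prop :=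
  forall t : R, t \in `[0, T] -> measurable_wrt (F t) (Y t).

Definition continuous_paths (R : realType) (d : measure_display)
    (Omega : measurableType d) (P : probability Omega R) (T : R)
    (Y : R -> Omega -> R) : Prop :=
  {ae P, forall w, {within `[0, T], continuous (fun t => Y t w)}}.

(* The product formula says at once that the increment is independent of [F s],
   that its components are independent, and that each is N(0, t - s). *)
Definition wiener (R : realType) (d : measure_display)
    (Omega : measurableType d) (P : probability Omega R) (T : R)
    (F : R -> set (set Omega)) (m : nat) (W : 'I_m -> R -> Omega -> R) : Prop :=
  [/\ forall i, adapted T F (W i),
      forall i, {ae P, forall w, W i 0 w = 0},
      forall i, continuous_paths P T (W i) &
      forall (s t : R) (A : set Omega) (B : 'I_m -> set R),
        0 <= s -> s < t -> t <= T -> F s A -> (forall i, measurable (B i)) ->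
        P (A `&` [set w | forall i, B i (W i t w - W i s w)]) =
        (P A * \prod_(i < m) normal_prob 0%R (Num.sqrt (t - s)%R) (B i))%E].

Definition is_partition (R : realType) (t : R) (n : nat) (tau : nat -> R) :
    Prop :=
  [/\ tau 0%N = 0, tau n = t & forall k, (k < n)%N -> tau k <= tau k.+1].

Definition mesh (R : realType) (n : nat) (tau : nat -> R) : R :=
  \big[Num.max/0]_(k < n) (tau k.+1 - tau k).

(* The step process equal to [sp_val k] on (sp_time k, sp_time k.+1]. *)
Record simple_process (R : realType) (Omega : Type) := SimpleProcess {
  sp_size : nat;
  sp_time : nat -> R;
  sp_val : nat -> Omega -> R }.

Definition simple_adapted (R : realType) (Omega : Type) (T : R)
    (F : R -> set (set Omega)) (S : simple_process R Omega) : Prop :=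
  is_partition T (sp_size S) (sp_time S) /\
  forall k, (k < sp_size S)%N ->
    measurable_wrt (F (sp_time S k)) (sp_val S k) /\
    exists M : R, forall w, `|sp_val S k w| <= M.

Definition simple_at (R : realType) (Omega : Type) (S : simple_process R Omega)
    (s : R) (w : Omega) : R :=
  \sum_(k < sp_size S)
     sp_val S k w * \1_(`]sp_time S k, sp_time S k.+1]%classic : set R) s.

Definition simple_integral (R : realType) (Omega : Type)
    (S : simple_process R Omega) (W : R -> Omega -> R) (t : R) (w : Omega) : R :=
  \sum_(k < sp_size S)
     sp_val S k w * (W (Num.min (sp_time S k.+1) t) w
                     - W (Num.min (sp_time S k) t) w).

(* [J] is (a version of) the Ito integral of [H] against [W]: the limit in
   probability of integrals of simple processes that converge to [H] in
   L^2(0, T) in probability. By the Ito isometry [J] does not depend, up to null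
   sets, on the approximating sequence; the existence of one forces
   \int_0^T H^2 ds < +oo almost surely. *)
Definition ito_integral (R : realType) (d : measure_display)
    (Omega : measurableType d) (P : probability Omega R) (T : R)
    (F : R -> set (set Omega)) (W H J : R -> Omega -> R) : Prop :=
  exists S : nat -> simple_process R Omega,
    [/\ forall n, simple_adapted T F (S n),
        cvg0_in_prob P (fun n w =>
          \int[@lebesgue_measure R]_(s in `[0%R, T])
             ((simple_at (S n) s w - H s w) ^+ 2)%R%:E)%E &
        forall t : R, t \in `[0, T] ->
          cvg0_in_prob P (fun n w =>
            `|simple_integral (S n) W t w - J t w|%:E)].

Definition covariation (R : realType) (d : measure_display)
    (Omega : measurableType d) (P : probability Omega R) (T : R)
    (H W Q : R -> Omega -> R) : Prop :=
  forall t : R, t \in `[0, T] ->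
  forall (N : nat -> nat) (tau : nat -> nat -> R),
    (forall n, is_partition t (N n) (tau n)) ->
    (fun n => mesh (N n) (tau n)) @ \oo --> (0 : R) ->
    cvg0_in_prob P (fun n w =>
      `|\sum_(k < N n) (H (tau n k.+1) w - H (tau n k) w)
                       * (W (tau n k.+1) w - W (tau n k) w) - Q t w|%:E).

Inductive calculus := Ito | Stratonovich.

Definition stochastic_integral (c : calculus) (R : realType)
    (d : measure_display) (Omega : measurableType d) (P : probability Omega R)
    (T : R) (F : R -> set (set Omega)) (W H J : R -> Omega -> R) : Prop :=
  match c with
  | Ito => ito_integral P T F W H J
  | Stratonovich => exists J0 Q : R -> Omega -> R,
      [/\ ito_integral P T F W H J0, covariation P T H W Q &
          forall (t : R) w, t \in `[0, T] -> J t w = J0 t w + Q t w / 2]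
  end.

(* The state is one-dimensional; the Wiener process is [m]-dimensional. *)
Definition sde_solution (c : calculus) (R : realType) (T gamma : R)
    (d : measure_display) (Omega : measurableType d) (P : probability Omega R)
    (m : nat) (F : R -> set (set Omega)) (W : 'I_m -> R -> Omega -> R)
    (a : R -> R -> R) (b : 'I_m -> R -> R -> R) (X : R -> {RV P >-> R}) : Prop :=
  [/\ filtration T F /\ wiener P T F W,
      [/\ measurable_fun (`[0, T] `*` `]- gamma, gamma[)
            (fun p : R * R => a p.1 p.2) &
          forall i, measurable_fun (`[0, T] `*` `]- gamma, gamma[)
            (fun p : R * R => b i p.1 p.2)],
      [/\ forall (t : R) w, t \in `[0, T] -> X t w \in `]- gamma, gamma[,
          adapted T F (fun t w => X t w) &
          continuous_paths P T (fun t w => X t w)],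
      {ae P, forall w, (@lebesgue_measure R).-integrable `[0, T]
         (fun s => (a s (X s w))%:E)} &
      exists J : 'I_m -> R -> Omega -> R,
        (forall i, stochastic_integral c P T F (W i)
                     (fun s w => b i s (X s w)) (J i)) /\
        forall t : R, t \in `[0, T] -> {ae P, forall w,
          X t w = X 0 w
                  + \int[@lebesgue_measure R]_(s in `[0, t]) a s (X s w)
                  + \sum_(i < m) J i t w}].

(* Main.v *)
(* Write u = phi - Psi and v = Psi - pi. Comparing the minimiser phi with the
   competitors phi - s u gives |u|^2 <= - <u, v>, and u is orthogonal to the
   polynomials of degree at most L, so |u|^2 <= - <u, v - p> for each such p.
   Hence |<g, u>| is controlled by the uniform distance of v to these
   polynomials. As v is the increment of rho over a time step dt, its second
   space derivative is O(dt), and Bernstein polynomials approximate it with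
   error O(dt / (L + 1)). *)
Require Import Defs.
From HB Require Import structures.
From mathcomp Require Import all_boot all_order all_algebra.
From mathcomp Require Import ring lra.
From mathcomp Require Import all_classical all_reals all_analysis.
From mathcomp Require Import measurable_realfun.
Set Implicit Arguments.
Unset Strict Implicit.
Unset Printing Implicit Defensive.
Import Order.TTheory GRing.Theory Num.Theory.
Import numFieldNormedType.Exports.
Local Open Scope classical_set_scope.
Local Open Scope ring_scope.

(** The rate comes from the variance of the binomial average behind a Bernstein polynomial,
    multiplied by a bound on the second space derivative. The factor dt has to come out at the same
    time. For this the mean value theorem in time is applied to the whole spatial Taylor remainder
    between two fixed points, and only then is the remainder of the time derivative, at the
    intermediate time, estimated in space. A bound on the mixed derivative [D 1 2] over the closed
    rectangle then suffices, so the constant is free of t, dt and L. Derivatives are known only in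
    the interior, whereas Bernstein polynomials sample the end points; continuity up to the boundary
    closes this gap. *)

(** * Bernstein polynomials and their rate of approximation *)

(** Absorption: k C(n+1, k) = (n+1) C(n, k-1). Each factor k is traded for one degree, so the first
    and second binomial moments reduce to the binomial theorem; [F] carries the factor that
    remains. *)
Lemma binomial_weight_shift (R : comNzRingType) (x y : R) (n : nat) (F : nat -> R) :
  \sum_(k < n.+2) (y ^+ (n.+1 - k) * x ^+ k) *+ 'C(n.+1, k) * (k%:R * F k) =
  n.+1%:R * x *
    \sum_(k < n.+1) (y ^+ (n - k) * x ^+ k) *+ 'C(n, k) * F k.+1.
Proof.
rewrite big_ord_recl mul0r mulr0 add0r mulr_sumr; apply: eq_bigr => k _.
rewrite lift0 subSS exprS.
have E : k.+1%:R * ('C(n.+1, k.+1))%:R = n.+1%:R * ('C(n, k))%:R :> R.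
  by rewrite -!natrM -mul_bin_diag.
rewrite -(mulr_natr _ 'C(n.+1, k.+1)) -(mulr_natr _ 'C(n, k)).
move: E; set b := _%:R; set c := _%:R; set N := _%:R; set e := _%:R => E.
have -> : y ^+ (n - k) * (x * x ^+ k) * c * (b * F k.+1)
    = b * c * (y ^+ (n - k) * x ^+ k * x * F k.+1) by ring.
by rewrite E; ring.
Qed.

Definition bernstein (R : fieldType) (n : nat) (f : R -> R) : {poly R} :=
  \sum_(k < n.+1)
    ((1 - 'X) ^+ (n - k) * 'X ^+ k) *+ 'C(n, k) * (f (k%:R / n%:R))%:P.

Lemma size_bernstein (R : fieldType) (n : nat) (f : R -> R) :
  (size (bernstein n f) <= n.+1)%N.
Proof.
apply: (leq_trans (size_sum _ _ _)); apply/bigmax_leqP => k _.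
rewrite mulrC mul_polyC (leq_trans (size_scale_leq _ _))//.
rewrite -mulr_natr -polyC_natr mulrC mul_polyC (leq_trans (size_scale_leq _ _))//.
rewrite (leq_trans (size_polyMleq _ _))// size_polyXn addnS /=.
have le2 : (size (1 - 'X : {poly R})%R <= 2)%N.
  by rewrite (leq_trans (size_polyD _ _))// size_polyN size_polyX size_poly1.
have le1 : (size ((1 - 'X : {poly R}) ^+ (n - k))%R <= (n - k).+1)%N.
  rewrite (leq_trans (size_poly_exp_leq _ _))// ltnS -[leqRHS]mul1n leq_mul2r.
  by rewrite -subn1 leq_subLR add1n le2 orbT.
have kn : (k <= n)%N by rewrite -ltnS.
by rewrite -[n in leqRHS](subnK kn) -addSn leq_add2r.
Qed.

(** The polynomial's value at x is the expectation of f (S / (n+1)) for S binomial with parameters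
    n+1 and x. The linear term with slope s averages to 0 because S / (n+1) has mean x, and the
    quadratic error averages to at most K times the variance x (1 - x) / (n+1). *)
Lemma bernstein_approx (R : realFieldType) (n : nat) (f : R -> R) (x s K : R) :
  0 <= x <= 1 -> 0 <= K ->
  (forall y, 0 <= y <= 1 -> `|f y - f x - s * (y - x)| <= K * (y - x) ^+ 2) ->
  `|(bernstein n.+1 f).[x] - f x| <= K / n.+1%:R.
Proof.
move=> /andP[x0 x1] K0 Hf.
pose w (k : nat) := ((1 - x) ^+ (n.+1 - k) * x ^+ k) *+ 'C(n.+1, k).
have w0 k : 0 <= w k by rewrite mulrn_wge0// mulr_ge0// exprn_ge0// subr_ge0.
have sw m : \sum_(k < m.+1) ((1 - x) ^+ (m - k) * x ^+ k) *+ 'C(m, k) = 1.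
  by rewrite -exprDn subrK expr1n.
have sw1 m : \sum_(k < m.+1) ((1 - x) ^+ (m - k) * x ^+ k) *+ 'C(m, k) * k%:R
    = m%:R * x.
  case: m => [|m]; first by rewrite big_ord1 mulr0 mul0r.
  rewrite -(eq_bigr _ (fun _ _ => congr1 (fun z => _ * z) (mulr1 _))).
  rewrite (binomial_weight_shift x (1 - x) m (fun=> 1)).
  by rewrite (eq_bigr _ (fun _ _ => mulr1 _)) sw mulr1.
have sw2 : \sum_(k < n.+2) w k * (k%:R * k%:R) = n.+1%:R * x * (n%:R * x + 1).
  rewrite (binomial_weight_shift x (1 - x) n (fun k => k%:R)); congr (_ * _).
  under eq_bigr do rewrite -natr1 mulrDr mulr1.
  by rewrite big_split /= sw sw1.
have N0 : (0 : R) < n.+1%:R by rewrite ltr0Sn.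
have N0' : n.+1%:R != 0 :> R by rewrite gt_eqF.
have mean : \sum_(k < n.+2) w k * (k%:R / n.+1%:R - x) = 0.
  under eq_bigr do rewrite mulrBr mulrA.
  by rewrite sumrB -!mulr_suml sw sw1 mul1r mulrAC divff// mul1r subrr.
have var : \sum_(k < n.+2) w k * (k%:R / n.+1%:R - x) ^+ 2
    = x * (1 - x) / n.+1%:R.
  transitivity (\sum_(k < n.+2) (w k * (k%:R * k%:R) * n.+1%:R ^- 2
      - w k * k%:R * (2 * x / n.+1%:R) + w k * x ^+ 2)).
    apply: eq_bigr => k _; by field.
  rewrite big_split sumrB /= -!mulr_suml sw sw1 sw2 -natr1.
  by field; rewrite natr1.
have -> : (bernstein n.+1 f).[x] - f x =
    \sum_(k < n.+2) w k * (f (k%:R / n.+1%:R) - f x - s * (k%:R / n.+1%:R - x)).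
  under [RHS]eq_bigr do rewrite mulrBr mulrBr (mulrCA _ s).
  rewrite !sumrB -mulr_sumr mean mulr0 subr0 -mulr_suml sw mul1r; congr (_ - _).
  rewrite /bernstein horner_sum; apply: eq_bigr => k _.
  by rewrite hornerM hornerC hornerMn hornerM !horner_exp !hornerE.
apply: (le_trans (ler_norm_sum _ _ _)).
apply: (@le_trans _ _ (\sum_(k < n.+2) K * (w k * (k%:R / n.+1%:R - x) ^+ 2))).
  apply: ler_sum => k _; rewrite normrM (ger0_norm (w0 _)) mulrCA ler_wpM2l//.
  apply: Hf; rewrite divr_ge0//= ler_pdivrMr// mul1r ler_nat -ltnS.
  exact: ltn_ord.
rewrite -mulr_sumr var ler_wpM2l// ler_piMl ?invr_ge0 ?(ltW N0)//.
nra.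
Qed.

(** Affine transport from [0, 1] to the symmetric interval, which multiplies the quadratic constant
    by the squared length. The point y must range over the closed interval because the Bernstein
    nodes include both end points. *)
Lemma polynomial_approx (R : realFieldType) (gamma : R) (n : nat) (f : R -> R)
    (K : R) : 0 < gamma -> 0 <= K ->
  (forall x, x \in `]- gamma, gamma[ -> exists s,
     forall y, y \in `[- gamma, gamma] ->
       `|f y - f x - s * (y - x)| <= K * (y - x) ^+ 2) ->
  exists2 p : {poly R}, (size p <= n.+2)%N &
    forall x, x \in `]- gamma, gamma[ ->
      `|f x - p.[x]| <= K * (2 * gamma) ^+ 2 / n.+1%:R.
Proof.
move=> g0 K0 Hf.
pose h u := f (2 * gamma * u - gamma).
pose q : {poly R} := (2 * gamma)^-1 *: 'X + (2^-1)%:P.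
exists (bernstein n.+1 h \Po q).
  have sq : (size q <= 2)%N.
    rewrite (leq_trans (size_polyD _ _))// geq_max.
    rewrite (leq_trans (size_scale_leq _ _)) ?size_polyX//.
    by rewrite (leq_trans (size_polyC_leq1 _)).
  rewrite (leq_trans (size_comp_poly_leq _ _))// ltnS.
  rewrite -[leqRHS]muln1 leq_mul// -subn1 leq_subLR ?add1n//.
  exact: size_bernstein.
move=> x xg; have [s Hs] := Hf x xg.
have g0' : gamma != 0 by rewrite gt_eqF.
rewrite horner_comp distrC.
set z := q.[x].
have zE : z = (x + gamma) / (2 * gamma).
  by rewrite /z /q !hornerE; field.
have -> : f x = h z by rewrite /h zE; congr f; field.
(* By the chain rule, the slope in the rescaled variable is s times the length. *)
apply: (@bernstein_approx _ _ _ _ (s * (2 * gamma))).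
- move: xg; rewrite in_itv /= => /andP[? ?].
  rewrite zE ler_pdivrMr ?ler_pdivlMr; lra.
- by rewrite mulr_ge0// sqr_ge0.
- move=> y /andP[y0 y1].
  have /= := Hs (2 * gamma * y - gamma).
  rewrite in_itv /=.
  have -> : - gamma <= 2 * gamma * y - gamma <= gamma by nra.
  move=> /(_ isT).
  have -> : f x = h z by rewrite /h zE; congr f; field.
  rewrite -/(h y).
  have -> : 2 * gamma * y - gamma - x = 2 * gamma * (y - z).
    by rewrite zE; field.
  by rewrite exprMn !mulrA.
Qed.

(** * Mean value estimates for the time increment of a smooth function *)

Lemma within_setX_continuousl (S T U : topologicalType) (A : set S) (B : set T)
    (F : S -> T -> U) (y : T) :
  {within A `*` B, continuous (fun p : S * T => F p.1 p.2)} -> B y ->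
  {within A, continuous (F^~ y)}.
Proof.
move=> /subspace_continuousP FC By; apply/subspace_continuousP => t At V nV.
have /(_ _ nV) := FC (t, y) (conj At By).
have Ht : (fun s => (s, y)) @ t --> (t, y).
  exact: (cvg_pair cvg_id (cvg_cst y)).
move=> /Ht /=; rewrite !nbhs_simpl /within /=.
by apply: filterS => s /= H As; apply: H; split.
Qed.

Lemma within_setX_continuousr (S T U : topologicalType) (A : set S) (B : set T)
    (F : S -> T -> U) (x : S) :
  {within A `*` B, continuous (fun p : S * T => F p.1 p.2)} -> A x ->
  {within B, continuous (F x)}.
Proof.
move=> /subspace_continuousP FC Ax; apply/subspace_continuousP => t Bt V nV.
have /(_ _ nV) := FC (x, t) (conj Ax Bt).
have Ht : (fun s => (x, s)) @ t --> (x, t).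
  exact: (cvg_pair (cvg_cst x) cvg_id).
move=> /Ht /=; rewrite !nbhs_simpl /within /=.
by apply: filterS => s /= H As; apply: H; split.
Qed.

Lemma within_itv_ge0 (R : realType) (a b : R) (h : R -> R) :
  {within `[a, b], continuous h} -> a < b ->
  (forall y, y \in `]a, b[ -> 0 <= h y) -> forall y, y \in `[a, b] -> 0 <= h y.
Proof.
move=> hC ab h0 y; rewrite in_itv /= => /andP[].
have [_ ha hb] := (continuous_within_itvP h ab).1 hC.
rewrite le_eqVlt => /predU1P[<- _|ay].
  apply: (cvgr_to_ge ha); near=> z; apply: h0; rewrite in_itv /=.
  by apply/andP; split; near: z; [exact: nbhs_right_gt|exact: nbhs_right_lt].
rewrite le_eqVlt => /predU1P[->|yb]; last by apply: h0; rewrite in_itv /= ay yb.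
apply: (cvgr_to_ge hb); near=> z; apply: h0; rewrite in_itv /=.
by apply/andP; split; near: z; [exact: nbhs_left_gt|exact: nbhs_left_lt].
Unshelve. all: by end_near. Qed.

(** The points x and y come in either order, and c is no farther from x than y is; this lets the
    mean value theorem be applied a second time between x and c. *)
Lemma MVT_itvoo (R : realType) (a b : R) (f df : R -> R) (x y : R) :
  (forall z, z \in `]a, b[ -> is_derive z 1 f (df z)) ->
  x \in `]a, b[ -> y \in `]a, b[ ->
  exists c, [/\ c \in `]a, b[, `|c - x| <= `|y - x| & f y - f x = df c * (y - x)].
Proof.
move=> fd.
have lt_case u v : u < v -> u \in `]a, b[ -> v \in `]a, b[ ->
    exists2 c, c \in `]u, v[ & f v - f u = df c * (v - u).
  move=> uv; rewrite [u \in _]in_itv [v \in _]in_itv /= => /andP[au _] /andP[_ vb].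
  have sub z : u <= z <= v -> z \in `]a, b[.
    by move=> /andP[uz zv]; rewrite in_itv /= (lt_le_trans au uz) (le_lt_trans zv vb).
  have fuvd z : z \in `]u, v[ -> is_derive z 1 f (df z).
    by rewrite in_itv /= => /andP[uz zv]; apply/fd/sub; rewrite (ltW uz) (ltW zv).
  have fuvC : {within `[u, v], continuous f}.
    by apply: derivable_within_continuous => z; rewrite in_itv /= => /sub/fd[].
  have [c cuv E] := MVT uv fuvd fuvC.
  by exists c.
move=> xab yab; have [xy|yx|<-] := ltgtP x y.
- have [c cxy E] := lt_case _ _ xy xab yab; exists c; split=> //.
    move: cxy xab yab; rewrite !in_itv /= => /andP[? ?] /andP[? ?] /andP[? ?].
    by apply/andP; split; lra.
  move: cxy; rewrite in_itv /= => /andP[? ?].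
  by rewrite !ger0_norm; lra.
- have [c cxy E] := lt_case _ _ yx yab xab; exists c; split.
  + move: cxy xab yab; rewrite !in_itv /= => /andP[? ?] /andP[? ?] /andP[? ?].
    by apply/andP; split; lra.
  + move: cxy; rewrite in_itv /= => /andP[? ?].
    by rewrite !ler0_norm; lra.
  + by rewrite -opprB E -mulrN opprB.
- by exists x; split=> //; rewrite !subrr mulr0.
Qed.

(** Two mean value steps write the remainder as f2 e (c - x) (y - x) with c between x and y. The
    factor 1/2 of Taylor's formula is given up, which spares any integral remainder. *)
Lemma taylor1_itvoo (R : realType) (a b : R) (f f1 f2 : R -> R) (K x y : R) :
  (forall z, z \in `]a, b[ -> is_derive z 1 f (f1 z)) ->
  (forall z, z \in `]a, b[ -> is_derive z 1 f1 (f2 z)) ->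
  (forall z, z \in `]a, b[ -> `|f2 z| <= K) ->
  x \in `]a, b[ -> y \in `]a, b[ ->
  `|f y - f x - f1 x * (y - x)| <= K * (y - x) ^+ 2.
Proof.
move=> fd f1d f2K xab yab.
have [c [cab cxy ->]] := MVT_itvoo fd xab yab.
have [e [eab ecx E]] := MVT_itvoo f1d xab cab.
rewrite -mulrBl E !normrM -mulrA -[(y - x) ^+ 2]real_normK ?num_real// expr2.
by rewrite ler_pM// ?f2K// ?mulr_ge0// ler_wpM2r.
Qed.

Lemma compact_within_continuous_bounded (R : realType) (T : topologicalType)
    (A : set T) (f : T -> R) : compact A -> {within A, continuous f} ->
  exists M, forall x, A x -> `|f x| <= M.
Proof.
move=> cA fC; have /compact_bounded[M [_ HM]] := continuous_compact fC cA.
exists (M + 1) => x Ax; apply: (HM (M + 1)); first by rewrite ltrDl.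
by exists x.
Qed.

Lemma smooth_increment_bounds (R : realType) (gamma T : R) (rho : R -> R -> R) :
  0 < gamma -> smooth_on_rectangle T gamma rho ->
  exists K, 0 < K /\ forall t dt, t \in `[0, T] -> t + dt \in `[0, T] -> 0 < dt ->
    forall x, x \in `]- gamma, gamma[ ->
    `|rho (t + dt) x - rho t x| <= K * dt /\
    exists s, forall y, y \in `[- gamma, gamma] ->
      `|(rho (t + dt) y - rho t y) - (rho (t + dt) x - rho t x) - s * (y - x)|
        <= K * dt * (y - x) ^+ 2.
Proof.
move=> g0 [D [D0 DC Dt Dx]].
have cQ : compact (`[0, T] `*` `[- gamma, gamma] : set (R * R)).
  by apply: compact_setX; exact: segment_compact.
have [K0 HK0] := compact_within_continuous_bounded cQ (DC 1%N 0%N).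
have [K2 HK2] := compact_within_continuous_bounded cQ (DC 1%N 2%N).
(* The 1 makes K strictly positive: the approximation error will later serve as a divisor. *)
exists (Num.max 1 (Num.max K0 K2)); split; first by rewrite lt_max ltr01.
set K := Num.max 1 _.
have K0K : K0 <= K by rewrite !le_max lexx orbT.
have K2K : K2 <= K by rewrite !le_max lexx !orbT.
move=> t dt tT tdT dt0 x xg.
have oc z : z \in `]- gamma, gamma[ -> z \in `[- gamma, gamma].
  by rewrite !in_itv /= => /andP[/ltW-> /ltW->].
have itT z : z \in `]t, t + dt[ -> z \in `]0, T[.
  move: tT tdT; rewrite !in_itv /= => /andP[? ?] /andP[? ?] /andP[? ?].
  by apply/andP; split; lra.
have octT z : z \in `]0, T[ -> z \in `[0, T].
  by rewrite !in_itv /= => /andP[/ltW-> /ltW->].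
have tC (F : R -> R) : {within `[0, T], continuous F} ->
    {within `[t, t + dt], continuous F}.
  apply: continuous_subspaceW => z /=.
  move: tT tdT; rewrite !in_itv /= => /andP[? ?] /andP[? ?] /andP[? ?].
  by apply/andP; split; lra.
have DtC i j z : z \in `[- gamma, gamma] -> {within `[0, T], continuous (D i j ^~ z)}.
  by move=> zg; exact: within_setX_continuousl (DC i j) zg.
have tdt : t < t + dt by rewrite ltrDl.
have dtE : t + dt - t = dt by rewrite addrAC subrr add0r.
split.
  rewrite -!D0 ?oc//.
  have [s sI ->] := MVT tdt (fun s sI => Dt 0%N 0%N s x (itT s sI) xg)
    (tC _ (DtC _ _ _ (oc _ xg))).
  rewrite dtE normrM (gtr0_norm dt0) ler_wpM2r ?(ltW dt0)//.
  apply: le_trans K0K; apply: (HK0 (s, x)); split => /=.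
    exact: octT (itT _ sI).
  exact: oc.
pose s := D 0%N 1%N (t + dt) x - D 0%N 1%N t x; exists s.
(* [D i.+1 j] is the time derivative of [D i j] at interior points only, so
   the endpoints [y = - gamma, gamma] are reached by continuity below. *)
have oo_bound y : y \in `]- gamma, gamma[ ->
    `|(rho (t + dt) y - rho t y) - (rho (t + dt) x - rho t x) - s * (y - x)|
        <= K * dt * (y - x) ^+ 2.
  move=> yg; rewrite -!D0 ?oc//.
  (* [Phi r] is the spatial Taylor remainder of the density at time r. Its increment over the time
     step is the quantity to bound, and its time derivative [dPhi r] is the Taylor remainder of
     [D 1 0 r]. *)
  pose Phi r := D 0%N 0%N r y - D 0%N 0%N r x - D 0%N 1%N r x * (y - x).
  pose dPhi r := D 1%N 0%N r y - D 1%N 0%N r x - D 1%N 1%N r x * (y - x).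
  have PhiC : {within `[t, t + dt], continuous Phi}.
    apply: tC => r; apply: cvgB; last first.
      by apply: cvgM; [exact: (DtC 0%N 1%N x (oc _ xg))|exact: cvg_cst].
    by apply: cvgB; [exact: (DtC 0%N 0%N y (oc _ yg))|
      exact: (DtC 0%N 0%N x (oc _ xg))].
  have Phid r : r \in `]t, t + dt[ -> is_derive r 1 Phi (dPhi r).
    move=> /itT rT; have d1 := Dt 0%N 0%N r y rT yg.
    have d2 := Dt 0%N 0%N r x rT xg; have d3 := Dt 0%N 1%N r x rT xg.
    rewrite /Phi /dPhi; apply: is_derive_eq.
    by rewrite /GRing.scale /= mulr0 add0r [(y - x) * _]mulrC.
  (* The time r depends on x and y, but the bound on [D 1 2] is uniform in it. *)
  have [r rI] := MVT tdt Phid PhiC.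
  have -> : Phi (t + dt) - Phi t =
      (D 0%N 0%N (t + dt) y - D 0%N 0%N t y) -
      (D 0%N 0%N (t + dt) x - D 0%N 0%N t x) - s * (y - x).
    by rewrite /Phi /s; ring.
  move=> ->; rewrite dtE normrM (gtr0_norm dt0) mulrAC ler_wpM2r ?(ltW dt0)//.
  have rT := itT _ rI.
  apply: (taylor1_itvoo (f2 := D 1%N 2%N r) (fun z zg => Dx 1%N 0%N r z rT zg)
    (fun z zg => Dx 1%N 1%N r z rT zg)) xg yg => z zg.
  by apply: le_trans K2K; apply: (HK2 (r, z)); split; [exact: octT|exact: oc].
move=> y yg; rewrite -subr_ge0.
pose h z := K * dt * (z - x) ^+ 2 -
  `|(rho (t + dt) z - rho t z) - (rho (t + dt) x - rho t x) - s * (z - x)|.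
rewrite -/(h y); apply: (@within_itv_ge0 _ (- gamma) gamma h) yg; last 2 first.
- by rewrite gtrN.
- by move=> z zg; rewrite subr_ge0; exact: oo_bound.
have rC r : r \in `[0, T] -> {within `[- gamma, gamma], continuous (rho r)}.
  move=> rT; apply: (@subspace_eq_continuous _ _ _ (D 0%N 0%N r)).
    by move=> z; rewrite inE => zg; exact: D0.
  exact: within_setX_continuousr (DC 0%N 0%N) rT.
have idC : {within `[- gamma, gamma], continuous (fun z : R => z - x)}.
  by apply: continuous_subspaceT => z; apply: cvgB; [exact: cvg_id|exact: cvg_cst].
move=> z; apply: cvgB.
  apply: cvgM; first exact: cvg_cst.
  by apply: cvgM; exact: idC.
apply: cvg_norm; apply: cvgB; last by apply: cvgM; [exact: cvg_cst|exact: idC].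
apply: cvgB; last exact: cvg_cst.
by apply: cvgB; [exact: (rC _ tdT)|exact: (rC _ tT)].
Qed.

(** * Expectations as integrals against a density *)

Lemma has_density_integrable (R : realType) (gamma : R) (d : measure_display)
    (Omega : measurableType d) (P : probability Omega R) (Y : {RV P >-> R})
    (f : R -> R) : has_density gamma Y f ->
  (@lebesgue_measure R).-integrable `]- gamma, gamma[ (EFin \o f) /\
  \int[@lebesgue_measure R]_(x in `]- gamma, gamma[) f x = 1.
Proof.
move=> [_ mf f0 dY].
have D1 : (\int[@lebesgue_measure R]_(x in `](- gamma)%R, gamma[) (f x)%:E = 1)%E.
  have := dY setT measurableT; rewrite setTI => <-.
  by rewrite /distribution /pushforward /= preimage_setT probability_setT.
split; last by rewrite /Rintegral D1.
apply/integrableP; split; first exact/measurable_EFinP.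
(* Since f is nonnegative almost everywhere, the integral of its absolute value equals its integral,
   which is the total mass 1. *)
rewrite (_ : (\int[_]_(x in _) _)%E = 1%E) ?ltry// -D1; apply: ae_eq_integral => //.
- by apply: measurableT_comp => //; exact/measurable_EFinP.
- exact/measurable_EFinP.
- apply: (negligibleS _ f0) => x /= + fx0; apply => xD.
  by rewrite ger0_norm// fx0.
Qed.

(** The restriction of f to D and the Radon-Nikodym derivative of nu have the same integral over
    every measurable set, so they agree almost everywhere; the change of variables for the
    derivative then gives the formula. *)
Lemma integral_measure_density (d : measure_display) (T : measurableType d)
    (R : realType) (mu : {sigma_finite_measure set T -> \bar R})
    (nu : {finite_measure set T -> \bar R}) (D : set T) (f h : T -> \bar R) :
  measurable D -> mu.-integrable D f ->
  (forall A, measurable A -> nu A = \int[mu]_(x in A `&` D) f x)%E ->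
  nu.-integrable setT h ->
  (\int[nu]_x h x = \int[mu]_(x in D) (h x * f x))%E.
Proof.
move=> mD fI nuE hI; have mf := measurable_int _ fI.
have mfD : measurable_fun setT (f \_ D) by apply/(measurable_restrictT _ _).1.
have mh : measurable_fun setT h := measurable_int _ hI.
have dom : nu `<< mu.
  apply/null_content_dominatesP => A mA A0.
  rewrite nuE// null_set_integral//; first exact: measurableI.
    by apply: measurable_funS mf.
  apply/eqP; rewrite eq_le measure_ge0 andbT -A0.
  by rewrite le_measure ?inE//; exact: measurableI.
rewrite -(Radon_Nikodym_change_of_variables dom)//.
rewrite [RHS]integral_mkcond; apply: ae_eq_integral => //.
- by apply: emeasurable_funM => //; apply: measurable_int; exact: Radon_Nikodym_integrable.
- apply/(measurable_restrictT _ _).1 => //; apply: emeasurable_funM => //.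
  exact: measurable_funS mh.
have -> : (fun x => h x * f x)%E \_ D = (h \* (f \_ D))%E.
  by apply/funext => x; rewrite /patch; case: ifPn => //; rewrite mule0.
apply: ae_eqe_mul2l; apply: integral_ae_eq => //.
- exact: Radon_Nikodym_integrable.
- move=> E _ mE; rewrite -Radon_Nikodym_integral//.
  by rewrite -integral_mkcondr; exact: nuE.
Qed.

Lemma expectation_has_density (R : realType) (gamma : R)
    (d : measure_display) (Omega : measurableType d) (P : probability Omega R)
    (Y : {RV P >-> R}) (f h : R -> R) (M : R) : has_density gamma Y f ->
  measurable_fun `]- gamma, gamma[ h ->
  (forall x, x \in `]- gamma, gamma[ -> `|h x| <= M) ->
  'E_P[fun w => h (Y w)]%E =
  (\int[@lebesgue_measure R]_(x in `]- gamma, gamma[) (h x * f x))%:E.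
Proof.
move=> hY mh hM; have [YD mf f0 dY] := hY; have [fI _] := has_density_integrable hY.
have hb : [bounded h x | x in `]- gamma, gamma[].
  exists M; split; first exact: num_real.
  by move=> r Mr x xD; rewrite /= (le_trans (hM _ xD))// ltW.
(* h is controlled on the interval only. Its extension by zero is measurable and bounded on the
   whole line, and agrees with h along Y, which stays in the interval. *)
pose k := h \_ `]- gamma, gamma[.
have mk : measurable_fun setT k by apply/(measurable_restrictT _ _).1.
have kY w : k (Y w) = h (Y w) by rewrite /k patchE mem_set//; exact: YD.
have kb : [bounded k x | x in setT].
  exists (Num.max M 0); split; first exact: num_real.
  move=> r; rewrite gt_max => /andP[Mr r0] x _ /=; rewrite /k patchE.
  case: ifPn => [|_]; last by rewrite normr0 ltW.
  by rewrite inE => xD; rewrite (le_trans (hM _ xD))// ltW.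
(* [distribution P Y] lives on [R] and [lebesgue_measure] on
   [measurableTypeR R]: same sigma-algebra, but distinct measurable types. *)
have mY : measurable_fun setT (Y : Omega -> measurableTypeR R).
  by have : measurable_fun setT Y by exact: measurable_funPT.
pose Y' : {RV P >-> measurableTypeR R} :=
  HB.pack (Y : Omega -> measurableTypeR R) (isMeasurableFun.Build _ _ _ _ _ mY).
have kI : (distribution P Y').-integrable setT (EFin \o k).
  apply: measurable_bounded_integrable => //.
  by rewrite ltey_eq fin_num_measure.
have hfI : (@lebesgue_measure R).-integrable `]- gamma, gamma[
    (fun x => (h x * f x)%:E).
  have -> : (fun x => (h x * f x)%:E) = ((EFin \o h) \* (EFin \o f))%E by [].
  exact: integrableMr.
rewrite unlock.
transitivity (\int[P]_w ((EFin \o k) \o Y') w)%E.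
  by apply: eq_integral => w _ /=; rewrite kY.
transitivity (\int[distribution P Y']_y (EFin \o k) y)%E.
  apply/esym/(@integral_distribution _ _ _ (measurableTypeR R) _ P Y').
    exact/measurable_EFinP.
  have -> : (EFin \o k) \o Y' = EFin \o (k \o Y') by [].
  apply: measurable_bounded_integrable => //.
  + by rewrite ltey_eq fin_num_measure.
  + exact: measurableT_comp.
  + have [K [Kr HK]] := kb; exists K; split => // r Kr' w _; exact: HK.
have dY' (A : set (measurableTypeR R)) : measurable A -> distribution P Y' A =
    (\int[@lebesgue_measure R]_(x in A `&` `](- gamma)%R, gamma[) (EFin \o f) x)%E.
  exact: dY.
transitivity (\int[@lebesgue_measure R]_(x in `](- gamma)%R, gamma[)
    ((EFin \o k) x * (EFin \o f) x))%E.
  exact: (integral_measure_density _ fI dY' kI).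
rewrite /Rintegral fineK; last exact: integrable_fin_num.
by apply: eq_integral => x xD; rewrite /= /k patchE xD EFinM.
Qed.

(** * Quadratic estimates for square-integrable functions *)

(** Measurability is a separate clause because integrability of the square does not imply it. *)
Definition sqr_integrable (d : measure_display) (T : measurableType d)
    (R : realType) (mu : {measure set T -> \bar R}) (D : set T) (f : T -> R) :=
  measurable_fun D f /\ mu.-integrable D (fun x => (f x ^+ 2)%:E).

Lemma integrable_linear (d : measure_display) (T : measurableType d)
    (R : realType) (mu : {measure set T -> \bar R}) (D : set T) (f h : T -> R)
    (a b : R) : measurable D ->
  mu.-integrable D (EFin \o f) -> mu.-integrable D (EFin \o h) ->
  mu.-integrable D (fun x => (a * f x + b * h x)%:E).
Proof.
move=> mD fI hI.
have := integrableD mD (integrableZl mD a fI) (integrableZl mD b hI).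
by apply: eq_integrable => // x _; rewrite /= EFinD !EFinM.
Qed.

Lemma Rintegral_linear (d : measure_display) (T : measurableType d)
    (R : realType) (mu : {measure set T -> \bar R}) (D : set T) (f h : T -> R)
    (a b : R) : measurable D ->
  mu.-integrable D (EFin \o f) -> mu.-integrable D (EFin \o h) ->
  \int[mu]_(x in D) (a * f x + b * h x) =
  a * (\int[mu]_(x in D) f x) + b * (\int[mu]_(x in D) h x).
Proof.
move=> mD fI hI; rewrite RintegralD ?RintegralZl//.
  by have := integrableZl mD a fI; apply: eq_integrable => // x _; rewrite /= EFinM.
by have := integrableZl mD b hI; apply: eq_integrable => // x _; rewrite /= EFinM.
Qed.

Lemma sqr_integrable_mul (d : measure_display) (T : measurableType d)
    (R : realType) (mu : {measure set T -> \bar R}) (D : set T) (f h : T -> R) :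
  measurable D -> sqr_integrable mu D f -> sqr_integrable mu D h ->
  mu.-integrable D (fun x => (f x * h x)%:E).
Proof.
move=> mD [mf fI] [mh hI].
(* The product is dominated by the sum of the two squares. *)
apply: (le_integrable mD _ _ (integrable_linear 1 1 mD fI hI)).
  by apply/measurable_EFinP; exact: measurable_funM.
move=> x _ /=; rewrite lee_fin !mul1r.
rewrite [leRHS]ger0_norm ?addr_ge0 ?sqr_ge0// ler_norml.
by apply/andP; split; nra.
Qed.

Lemma sqr_integrable_linear (d : measure_display) (T : measurableType d)
    (R : realType) (mu : {measure set T -> \bar R}) (D : set T) (f h : T -> R)
    (a b : R) :
  measurable D -> sqr_integrable mu D f -> sqr_integrable mu D h ->
  sqr_integrable mu D (fun x => a * f x + b * h x).
Proof.
move=> mD fS hS; have [mf fI] := fS; have [mh hI] := hS; split.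
  by apply: measurable_funD; apply: measurable_funM => //; exact: measurable_cst.
have fhI := sqr_integrable_mul mD fS hS.
have H := integrable_linear (a ^+ 2) 1 mD fI
  (integrable_linear (2 * a * b) (b ^+ 2) mD fhI hI).
by apply: eq_integrable H => // x _; congr EFin; ring.
Qed.

Lemma Rintegral_sqr_linear (d : measure_display) (T : measurableType d)
    (R : realType) (mu : {measure set T -> \bar R}) (D : set T) (f h : T -> R)
    (a : R) :
  measurable D -> sqr_integrable mu D f -> sqr_integrable mu D h ->
  \int[mu]_(x in D) ((a * f x + h x) ^+ 2) =
  a ^+ 2 * (\int[mu]_(x in D) (f x ^+ 2)) +
  2 * a * (\int[mu]_(x in D) (f x * h x)) + \int[mu]_(x in D) (h x ^+ 2).
Proof.
move=> mD fS hS; have [mf fI] := fS; have [mh hI] := hS.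
have fhI := sqr_integrable_mul mD fS hS.
transitivity (\int[mu]_(x in D)
    (a ^+ 2 * f x ^+ 2 + 1 * (2 * a * (f x * h x) + 1 * h x ^+ 2))).
  by apply: eq_Rintegral => x _; ring.
rewrite Rintegral_linear//; last exact: integrable_linear.
by rewrite Rintegral_linear// !mul1r addrA.
Qed.

Lemma bounded_sqr_integrable (d : measure_display) (T : measurableType d)
    (R : realType) (mu : {measure set T -> \bar R}) (D : set T) (f : T -> R)
    (M : R) : measurable D -> (mu D < +oo)%E -> measurable_fun D f ->
  (forall x, D x -> `|f x| <= M) -> sqr_integrable mu D f.
Proof.
move=> mD Dfin mf fM; split=> //.
apply: (measurable_bounded_integrable (f := fun x => f x ^+ 2)) => //.
  exact: measurable_funX.
exists (M ^+ 2); split; first exact: num_real.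
move=> r Mr x Dx /=; rewrite normrX (le_trans _ (ltW Mr))//.
by rewrite ler_sqr ?nnegrE ?fM// (le_trans _ (fM _ Dx)).
Qed.

Lemma sqr_integrable_integrable (d : measure_display) (T : measurableType d)
    (R : realType) (mu : {measure set T -> \bar R}) (D : set T) (f : T -> R) :
  measurable D -> (mu D < +oo)%E -> sqr_integrable mu D f ->
  mu.-integrable D (EFin \o f).
Proof.
move=> mD Dfin fS.
have oneS : sqr_integrable mu D (fun=> 1).
  by apply: (@bounded_sqr_integrable _ _ _ _ _ _ 1) => // x _; rewrite normr1.
have := sqr_integrable_mul mD fS oneS.
by apply: eq_integrable => // x _; rewrite /= mulr1.
Qed.

(** With A = |u|^2 and B = <u, v>, the right-hand side is the objective at the competitor phi - s u,
    up to factor and constant. If A + B were positive, a small step s > 0 would lower it. *)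
Lemma quadratic_min_at0 (R : realFieldType) (A B : R) : 0 <= A ->
  (forall s, A + 2 * B <= (1 - s) ^+ 2 * A + 2 * (1 - s) * B) -> A + B <= 0.
Proof.
move=> A0 H; rewrite leNgt; apply/negP => AB0.
(* The 1 in the denominator covers A = 0 and keeps s A below A + B, so that s (s A - 2 (A + B)) is
   negative. *)
pose s := (A + B) / (A + 1).
have A1 : 0 < A + 1 by rewrite ltr_wpDl.
have s0 : 0 < s by rewrite divr_gt0.
have sA : s * A < A + B.
  rewrite /s mulrAC ltr_pdivrMr// ltr_pM2l// ltrDl ltr01//.
have := H s; rewrite -subr_ge0.
have -> : (1 - s) ^+ 2 * A + 2 * (1 - s) * B - (A + 2 * B) =
  s * (s * A - 2 * (A + B)) by ring.
by rewrite pmulr_rge0//; lra.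
Qed.

(** Weighted arithmetic-geometric inequalities replace Cauchy-Schwarz and avoid square roots.
    Orthogonality to p turns -B into -<u, v - p>, which is at most A / 2 + e^2 m / 2, whence A <=
    e^2 m. The pairing with g is then bounded by the integral of M |u|. *)
Lemma orthogonal_increment_bound (d : measure_display) (T : measurableType d)
    (R : realType) (mu : {measure set T -> \bar R}) (D : set T)
    (u v p g : T -> R) (e M : R) :
  measurable D -> (mu D < +oo)%E ->
  sqr_integrable mu D u -> sqr_integrable mu D v -> sqr_integrable mu D p ->
  \int[mu]_(x in D) (u x ^+ 2) + \int[mu]_(x in D) (u x * v x) <= 0 ->
  \int[mu]_(x in D) (u x * p x) = 0 ->
  0 < e -> (forall x, D x -> `|v x - p x| <= e) ->
  measurable_fun D g -> (forall x, D x -> `|g x| <= M) -> 0 <= M ->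
  `|\int[mu]_(x in D) (g x * u x)| <= M * e * fine (mu D).
Proof.
move=> mD Dfin uS vS pS; set A := \int[_]_(x in D) _; set B := \int[_]_(x in D) _.
move=> AB up e0 vp mg gM M0; set m := fine (mu D).
have e0' : e != 0 by rewrite gt_eqF.
have [mu_ uI] := uS; have uvI := sqr_integrable_mul mD uS vS.
have upI := sqr_integrable_mul mD uS pS.
have cI c : mu.-integrable D (EFin \o (fun=> c : R)).
  by apply: measurable_bounded_integrable => //; exists `|c|; split => // r cr x _; exact: ltW.
have cE c : \int[mu]_(x in D) c = c * m by exact: Rintegral_cst.
have AE : A <= e ^+ 2 * m.
  have : - B <= 2^-1 * A + 2^-1 * (e ^+ 2 * m).
    have -> : - B = \int[mu]_(x in D) (-1 * (u x * v x) + 1 * (u x * p x)).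
      by rewrite Rintegral_linear// up mulr0 addr0 mulN1r.
    rewrite -cE -Rintegral_linear//; apply: le_Rintegral => //.
    - exact: integrable_linear.
    - exact: integrable_linear.
    - move=> x Dx; have := vp _ Dx; rewrite ler_norml => /andP[h1 h2].
      have : (v x - p x) ^+ 2 <= e ^+ 2 by nra.
      have : 0 <= (u x + (v x - p x)) ^+ 2 by exact: sqr_ge0.
      nra.
  by lra.
have uI1 := sqr_integrable_integrable mD Dfin uS.
have gS := bounded_sqr_integrable mD Dfin mg gM.
have guI := sqr_integrable_mul mD gS uS.
apply: (le_trans (le_normr_Rintegral mD guI)).
(* The inequality |u| <= (u^2 + e^2) / (2 e) is balanced at |u| = e, the size allowed by [AE]. Each
   half contributes M e m / 2, the same constant as Cauchy-Schwarz would give. *)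
apply: (@le_trans _ _ (\int[mu]_(x in D) (M / (2 * e) * u x ^+ 2 + M * e / 2 * 1))).
  apply: le_Rintegral => //.
  - exact: (integrable_norm guI).
  - exact: integrable_linear.
  - move=> x Dx; rewrite normrM.
    apply: (@le_trans _ _ (M * `|u x|)); first by rewrite ler_wpM2r// gM.
    have -> : M / (2 * e) * u x ^+ 2 + M * e / 2 * 1 =
      M * ((`|u x| ^+ 2 + e ^+ 2) / (2 * e)).
      by rewrite real_normK ?num_real//; field.
    rewrite ler_wpM2l// ler_pdivlMr; last by lra.
    have : 0 <= (`|u x| - e) ^+ 2 by exact: sqr_ge0.
    nra.
rewrite Rintegral_linear// -/A cE.
have : M / (2 * e) * A <= M / (2 * e) * (e ^+ 2 * m).
  by rewrite ler_wpM2l// divr_ge0//; lra.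
have -> : M / (2 * e) * (e ^+ 2 * m) = M * e * m / 2 by field.
lra.
Qed.

(** * Moment matching and the minimiser in terms of real integrals *)

Lemma L2fun_sqr_integrable (R : realType) (gamma : R) (f : R -> R) :
  L2fun gamma f <-> sqr_integrable (@lebesgue_measure R) `]- gamma, gamma[ f.
Proof.
have mD : measurable (`]- gamma, gamma[%classic : set (measurableTypeR R)) by [].
have sqrE : (fun x => ((f x) ^+ 2)%:E) \_ `]- gamma, gamma[ =
    EFin \o (fun x => ((f \_ `]- gamma, gamma[) x) ^+ 2).
  apply/funext => x; rewrite /= /patch; case: ifPn => //.
  by rewrite expr0n.
split.
- move=> fL; have := Lfun2_integrable_sqr fL; rewrite -sqrE => H; split.
    move: fL; rewrite /L2fun inE => /andP[/[!inE] /= mf _].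
    exact: (@measurable_restrictT _ _ (measurableTypeR R) _ _ f mD).2.
  exact: ((integrable_mkcond _ mD).2 H).
- move=> [mf fI]; rewrite /L2fun inE; apply/andP; split; rewrite inE /=.
    exact: (@measurable_restrictT _ _ (measurableTypeR R) _ _ f mD).1.
  rewrite /finite_norm unlock /= poweR_lty//.
  have /integrable_lty := (integrable_mkcond _ mD).1 fI => /(_ measurableT).
  rewrite sqrE; apply: le_lt_trans; rewrite le_eqVlt; apply/orP; left; apply/eqP.
  apply: eq_integral => x _; rewrite /= powR_mulrn//.
  by rewrite real_normK ?num_real.
Qed.

Lemma L2norm_sqr (R : realType) (gamma : R) (f : R -> R) : L2fun gamma f ->
  (L2norm gamma f ^+ 2 =
   (\int[@lebesgue_measure R]_(x in `]- gamma, gamma[) (f x ^+ 2))%:E)%E.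
Proof.
move=> /L2fun_sqr_integrable[mf fI].
rewrite /L2norm unlock /=.
have -> : (\int[@lebesgue_measure R]_x
    ((`|(f \_ `]- gamma, gamma[) x| `^ 2)%R)%:E =
   (\int[@lebesgue_measure R]_(x in `](- gamma)%R, gamma[) ((f x ^+ 2)%R)%:E))%E.
  rewrite [RHS]integral_mkcond; apply: eq_integral => x _.
  rewrite powR_mulrn// real_normK ?num_real// /patch; case: ifPn => //.
  by rewrite expr0n.
rewrite /Rintegral; set I := (\int[_]_(x in _) _)%E.
have Ifin : I \is a fin_num by exact: integrable_fin_num.
have I0 : 0 <= fine I.
  by rewrite fine_ge0// integral_ge0// => x _; rewrite lee_fin sqr_ge0.
by rewrite -(fineK Ifin) poweR_EFin -EFinM -expr2 powR12_sqrt// sqr_sqrtr.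
Qed.

Lemma lebesgue_measure_symm_itv (R : realType) (gamma : R) : 0 < gamma ->
  @lebesgue_measure R `]- gamma, gamma[ = (2 * gamma)%:E.
Proof.
move=> g0; rewrite lebesgue_measure_itv /= lte_fin gtrN// -EFinB opprK.
by rewrite mulrDl mul1r.
Qed.

Lemma horner_sqr_integrable (R : realType) (gamma : R) (p : {poly R}) :
  0 < gamma ->
  sqr_integrable (@lebesgue_measure R) `]- gamma, gamma[ (fun x => p.[x]).
Proof.
move=> g0.
have pC : {within `[- gamma, gamma], continuous (horner p)}.
  by apply: continuous_subspaceT; exact: continuous_horner.
have Dfin : (@lebesgue_measure R `](- gamma)%R, gamma[ < +oo)%E.
  by rewrite lebesgue_measure_symm_itv// ltry.
have [M HM] := compact_within_continuous_bounded (@segment_compact R _ _) pC.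
apply: (@bounded_sqr_integrable _ _ _ _ _ _ M) => //.
- apply: subspace_continuous_measurable_fun => //.
  by apply: continuous_subspaceT; exact: continuous_horner.
- by move=> x xD; apply: HM; apply: subset_itv_oo_cc.
Qed.

Lemma moments_orthogonal (R : realType) (gamma : R) (L : nat) (f h : R -> R)
    (p : {poly R}) : 0 < gamma -> L2fun gamma f -> L2fun gamma h ->
  \int[@lebesgue_measure R]_(x in `]- gamma, gamma[) f x =
    \int[@lebesgue_measure R]_(x in `]- gamma, gamma[) h x ->
  moments gamma L f = moments gamma L h -> (size p <= L.+1)%N ->
  \int[@lebesgue_measure R]_(x in `]- gamma, gamma[) ((f x - h x) * p.[x]) = 0.
Proof.
move=> g0 /L2fun_sqr_integrable fS /L2fun_sqr_integrable hS E0 Em sp.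
have mD : measurable (`]- gamma, gamma[%classic : set (measurableTypeR R)) by [].
have uS : sqr_integrable (@lebesgue_measure R) `]- gamma, gamma[ (fun x => f x - h x).
  have := sqr_integrable_linear 1 (-1) mD fS hS.
  by congr sqr_integrable; apply/funext => x; ring.
have XS k : sqr_integrable (@lebesgue_measure R) `]- gamma, gamma[ (fun x => x ^+ k).
  have := @horner_sqr_integrable R gamma 'X^k g0.
  by congr sqr_integrable; apply/funext => x; rewrite hornerXn.
have powE k : (k <= L)%N ->
    \int[@lebesgue_measure R]_(x in `]- gamma, gamma[) ((f x - h x) * x ^+ k) = 0.
  move=> kL.
  transitivity (\int[@lebesgue_measure R]_(x in `]- gamma, gamma[)
      (1 * (x ^+ k * f x) + -1 * (x ^+ k * h x))).
    by apply: eq_Rintegral => x _; ring.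
  rewrite Rintegral_linear//; try exact: sqr_integrable_mul.
  (* [moments] starts at order 1, so the order 0 is supplied by the equality of masses [E0]. *)
  case: k kL => [_|k kL].
    under eq_Rintegral do rewrite expr0 mul1r.
    under [X in _ + -1 * X]eq_Rintegral do rewrite expr0 mul1r.
    by rewrite E0 mul1r mulN1r subrr.
  have /rowP/(_ (Ordinal kL)) := Em; rewrite !mxE /= => ->.
  by rewrite mul1r mulN1r subrr.
have : forall n, (n <= L.+1)%N ->
    \int[@lebesgue_measure R]_(x in `]- gamma, gamma[)
       ((f x - h x) * \sum_(i < n) p`_i * x ^+ i) = 0.
  elim=> [_|n IHn nL].
    under eq_Rintegral do rewrite big_ord0 mulr0.
    by rewrite Rintegral_cst// mul0r.
  transitivity (\int[@lebesgue_measure R]_(x in `]- gamma, gamma[)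
      (1 * ((f x - h x) * \sum_(i < n) p`_i * x ^+ i) +
       p`_n * ((f x - h x) * x ^+ n))).
    by apply: eq_Rintegral => x _; rewrite big_ord_recr /=; ring.
  rewrite Rintegral_linear//; last exact: sqr_integrable_mul.
    by rewrite IHn ?(ltnW nL)// powE// !mulr0 addr0.
  apply: sqr_integrable_mul => //.
  (* The partial sum is itself a polynomial, hence square-integrable. *)
  have := @horner_sqr_integrable R gamma (\poly_(i < n) p`_i) g0.
  by congr sqr_integrable; apply/funext => x; rewrite horner_poly.
move=> /(_ _ sp) <-; apply: eq_Rintegral => x _.
by rewrite horner_coef.
Qed.

(** Since psi is feasible, so is the whole line through phi and psi. With u = phi - psi and v = psi
    - prior, the objective at parameter s is half the squared norm of (1 - s) u + v; the term |v|^2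
    cancels and a quadratic in s remains. *)
Lemma is_phi2_variational (R : realType) (gamma : R) (L : nat)
    (prior phi psi : R -> R) : 0 < gamma ->
  is_phi2 gamma (moments gamma L psi) prior phi ->
  matching_feasible gamma (moments gamma L psi) psi -> L2fun gamma prior ->
  \int[@lebesgue_measure R]_(x in `]- gamma, gamma[) ((phi x - psi x) ^+ 2) +
  \int[@lebesgue_measure R]_(x in `]- gamma, gamma[)
    ((phi x - psi x) * (psi x - prior x)) <= 0.
Proof.
move=> g0 [[phiL phi1 phim] phimin] [psiL psi1 _] priorL.
have mD : measurable (`]- gamma, gamma[%classic : set (measurableTypeR R)) by [].
have Dfin : (@lebesgue_measure R `](- gamma)%R, gamma[ < +oo)%E.
  by rewrite lebesgue_measure_symm_itv// ltry.
have phiS := (L2fun_sqr_integrable _ _).1 phiL.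
have psiS := (L2fun_sqr_integrable _ _).1 psiL.
have priorS := (L2fun_sqr_integrable _ _).1 priorL.
pose u x := phi x - psi x; pose v x := psi x - prior x.
have uS : sqr_integrable (@lebesgue_measure R) `]- gamma, gamma[ u.
  have := sqr_integrable_linear 1 (-1) mD phiS psiS.
  by congr sqr_integrable; apply/funext => x; rewrite /u; ring.
have vS : sqr_integrable (@lebesgue_measure R) `]- gamma, gamma[ v.
  have := sqr_integrable_linear 1 (-1) mD psiS priorS.
  by congr sqr_integrable; apply/funext => x; rewrite /v; ring.
apply: quadratic_min_at0.
  by apply: Rintegral_ge0 => x _; exact: sqr_ge0.
move=> s.
(* This is phi - s u. Any real s is allowed, because the constraints are affine and contain no sign
   condition. *)
pose f x := (1 - s) * phi x + s * psi x.
have fS : sqr_integrable (@lebesgue_measure R) `]- gamma, gamma[ f.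
  exact: sqr_integrable_linear.
have fL : L2fun gamma f by exact/L2fun_sqr_integrable.
have ff : matching_feasible gamma (moments gamma L psi) f.
  split=> //.
  - rewrite Rintegral_linear//; try exact: sqr_integrable_integrable.
    by rewrite phi1 psi1 !mulr1 subrK.
  - apply/rowP => l; rewrite !mxE.
    have XS : sqr_integrable (@lebesgue_measure R) `]- gamma, gamma[
        (fun x => x ^+ l.+1).
      have := @horner_sqr_integrable R gamma 'X^(l.+1) g0.
      by congr sqr_integrable; apply/funext => x; rewrite hornerXn.
    transitivity (\int[@lebesgue_measure R]_(x in `]- gamma, gamma[)
      ((1 - s) * (x ^+ l.+1 * phi x) + s * (x ^+ l.+1 * psi x))).
      by apply: eq_Rintegral => x _; rewrite /f; ring.
    rewrite Rintegral_linear//; try exact: sqr_integrable_mul.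
    have /rowP/(_ l) := phim; rewrite !mxE => ->.
    by rewrite -mulrDl subrK mul1r.
have phipL : L2fun gamma (phi \- prior).
  apply/L2fun_sqr_integrable; have := sqr_integrable_linear 1 (-1) mD phiS priorS.
  by congr sqr_integrable; apply/funext => x /=; ring.
have fpL : L2fun gamma (f \- prior).
  apply/L2fun_sqr_integrable; have := sqr_integrable_linear 1 (-1) mD fS priorS.
  by congr sqr_integrable; apply/funext => x /=; ring.
have := phimin f ff.
rewrite !L2norm_sqr// -!EFinM lee_fin ler_pM2l ?invr_gt0 ?ltr0n//.
have -> : \int[@lebesgue_measure R]_(x in `]- gamma, gamma[) ((phi \- prior) x ^+ 2) =
    \int[@lebesgue_measure R]_(x in `]- gamma, gamma[) ((1 * u x + v x) ^+ 2).
  by apply: eq_Rintegral => x _; congr (_ ^+ 2); rewrite /u /v /=; ring.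
have -> : \int[@lebesgue_measure R]_(x in `]- gamma, gamma[) ((f \- prior) x ^+ 2) =
    \int[@lebesgue_measure R]_(x in `]- gamma, gamma[) (((1 - s) * u x + v x) ^+ 2).
  by apply: eq_Rintegral => x _; congr (_ ^+ 2); rewrite /u /v /f /=; ring.
by rewrite !Rintegral_sqr_linear// expr1n !mul1r mulr1 lerD2r.
Qed.

(** * Assembly of the estimate *)

Lemma smooth_increment_poly_approx (R : realType) (gamma T : R)
    (rho : R -> R -> R) : 0 < gamma -> smooth_on_rectangle T gamma rho ->
  exists2 K, 0 < K & forall (L : nat) (t dt : R),
    t \in `[0, T] -> t + dt \in `[0, T] -> 0 < dt ->
    exists2 p : {poly R}, (size p <= L.+1)%N &
      forall x, x \in `]- gamma, gamma[ ->
        `|(rho (t + dt) x - rho t x) - p.[x]| <= K / L.+1%:R * dt.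
Proof.
move=> g0 hrho; have [K [K0 HK]] := smooth_increment_bounds g0 hrho.
(* The summand 1 serves L = 0, where p = 0 and the increment itself is O(dt). For L = n + 1 the
   Bernstein error has the denominator L, and 1 / L <= 2 / (L + 1) accounts for the 2. *)
exists (K * (1 + 2 * (2 * gamma) ^+ 2)).
  by rewrite mulr_gt0// ltr_pwDl// mulr_ge0// sqr_ge0.
move=> [|n] t dt tT tdT dt0.
  exists 0; first by rewrite size_poly0.
  move=> x xg; have [/le_trans + _] := HK t dt tT tdT dt0 x xg.
  rewrite horner0 subr0 divr1; apply; rewrite ler_pM2r// ler_peMr ?(ltW K0)//.
  by rewrite lerDl mulr_ge0// sqr_ge0.
have KG : 0 <= K * dt by rewrite mulr_ge0// ltW.
have [p sp Hp] := polynomial_approx n g0 KG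
  (fun x xg => (HK t dt tT tdT dt0 x xg).2).
exists p => // x xg; apply: (le_trans (Hp x xg)).
have -> : K * (1 + 2 * (2 * gamma) ^+ 2) / n.+2%:R * dt =
  K * dt * ((1 + 2 * (2 * gamma) ^+ 2) / n.+2%:R) by ring.
rewrite -mulrA ler_wpM2l// ler_pdivrMr ?ltr0n// mulrAC ler_pdivlMr ?ltr0n//.
have : 0 <= (2 * gamma) ^+ 2 by exact: sqr_ge0.
rewrite -[n.+2%:R]natr1 -[n.+1%:R]natr1; have : 0 <= n%:R :> R by [].
set G := _ ^+ 2; set N := n%:R; nra.
Qed.

Theorem corollary4p7 (R : realType) (gamma T : R) (hgamma : 0 < gamma)
    (rho : R -> R -> R) (hrho : smooth_on_rectangle T gamma rho)
    (g : R -> R) (hg : {within `[- gamma, gamma], continuous g}) :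
  exists C : R,
  forall (d : measure_display) (Omega : measurableType d)
    (P : probability Omega R) (c : calculus) (m : nat)
    (F : R -> set (set Omega)) (W : 'I_m -> R -> Omega -> R)
    (a : R -> R -> R) (b : 'I_m -> R -> R -> R) (X : R -> {RV P >-> R}),
    sde_solution c T gamma F W a b X ->
    (forall t : R, t \in `[0, T] -> has_density gamma (X t) (rho t)) ->
  forall (L : nat) (t dt : R),
    t \in `[0, T] -> t + dt \in `[0, T] -> 0 < dt ->
  forall phi : R -> R,
    is_phi2 gamma (moments gamma L (rho (t + dt))) (rho t) phi ->
    {ae @lebesgue_measure R,
       forall x : R, x \in `]- gamma, gamma[ -> 0 <= phi x} ->
  forall (d' : measure_display) (Omega' : measurableType d')
    (P' : probability Omega' R) (Y : {RV P' >-> R}),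
    has_density gamma Y phi ->
    (`| 'E_P'[fun w => g (Y w)] - 'E_P[fun w => g (X (t + dt)%R w)] |
       <= (C / (L.+1)%:R * dt)%:E)%E.
Proof.
have mD : measurable (`]- gamma, gamma[%classic : set (measurableTypeR R)) by [].
have Dm := lebesgue_measure_symm_itv hgamma.
have Dfin : (@lebesgue_measure R `](- gamma)%R, gamma[ < +oo)%E by rewrite Dm ltry.
have [K K0 HK] := smooth_increment_poly_approx hgamma hrho.
have [M0 HM0] := compact_within_continuous_bounded (@segment_compact R _ _) hg.
pose M := Num.max M0 0.
have M_ge0 : 0 <= M by rewrite le_max lexx orbT.
have gM x : x \in `]- gamma, gamma[ -> `|g x| <= M.
  move=> xD; rewrite le_max; apply/orP; left; apply: HM0.
  exact: subset_itv_oo_cc.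
have mg : measurable_fun `]- gamma, gamma[ g.
  apply: (measurable_funS _ _ (subspace_continuous_measurable_fun _ hg)) => //.
  exact: subset_itv_oo_cc.
(* A bound for |g|, times the approximation constant of the density, times the length of the
   interval: all fixed before L, t, dt and the probability spaces are introduced. *)
exists (M * K * (2 * gamma)).
move=> d Omega P c m F W a b X _ Xd L t dt tT tdT dt0 phi phi2 _ d' Omega' P' Y Yd.
(* Measurability comes from the density property, boundedness from the continuous extension [D 0 0]
   to the closed rectangle. *)
have rhoL s : s \in `[0, T] -> L2fun gamma (rho s).
  move=> sT; apply/L2fun_sqr_integrable.
  have [D [D0 DC _ _]] := hrho.
  have sC : {within `[- gamma, gamma], continuous (D 0%N 0%N s)}.
    exact: (within_setX_continuousr (DC 0%N 0%N) sT).
  have [Ms HMs] := compact_within_continuous_bounded (@segment_compact R _ _) sC.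
  have [_ mr _ _] := Xd _ sT.
  apply: (@bounded_sqr_integrable _ _ _ _ _ _ Ms) => // x xD.
  by rewrite -D0 ?HMs//; exact: subset_itv_oo_cc.
have priorL := rhoL _ tT; have psiL := rhoL _ tdT.
(* The later density has the prescribed moments by construction and mass 1 as a density, so it is an
   admissible competitor. *)
have psif : matching_feasible gamma (moments gamma L (rho (t + dt))) (rho (t + dt)).
  by split=> //; have [] := has_density_integrable (Xd _ tdT).
have [[phiL phi1 phim] _] := phi2; have [_ psi1 _] := psif.
have phiS := (L2fun_sqr_integrable _ _).1 phiL.
have psiS := (L2fun_sqr_integrable _ _).1 psiL.
have priorS := (L2fun_sqr_integrable _ _).1 priorL.
have gS : sqr_integrable (@lebesgue_measure R) `]- gamma, gamma[ g.
  exact: (@bounded_sqr_integrable _ _ _ _ _ _ M).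
have [p sp Hp] := HK L t dt tT tdT dt0.
rewrite (expectation_has_density Yd mg gM) (expectation_has_density (Xd _ tdT) mg gM).
rewrite -EFinB abse_EFin lee_fin.
have -> : \int[@lebesgue_measure R]_(x in `]- gamma, gamma[) (g x * phi x) -
    \int[@lebesgue_measure R]_(x in `]- gamma, gamma[) (g x * rho (t + dt) x) =
    \int[@lebesgue_measure R]_(x in `]- gamma, gamma[)
      (g x * (phi x - rho (t + dt) x)).
  rewrite -RintegralB//; try exact: sqr_integrable_mul.
  by apply: eq_Rintegral => x _; rewrite mulrBr.
have -> : M * K * (2 * gamma) / L.+1%:R * dt =
    M * (K / L.+1%:R * dt) * fine (@lebesgue_measure R `]- gamma, gamma[).
  by rewrite Dm /=; ring.
have := @orthogonal_increment_bound _ _ _ (@lebesgue_measure R) `]- gamma, gamma[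
  (fun x => phi x - rho (t + dt) x) (fun x => rho (t + dt) x - rho t x)
  (fun x => p.[x]) g (K / L.+1%:R * dt) M mD Dfin.
apply.
- have := sqr_integrable_linear 1 (-1) mD phiS psiS.
  by congr sqr_integrable; apply/funext => x; ring.
- have := sqr_integrable_linear 1 (-1) mD psiS priorS.
  by congr sqr_integrable; apply/funext => x; ring.
- exact: horner_sqr_integrable.
- exact: is_phi2_variational hgamma phi2 psif priorL.
- apply: moments_orthogonal sp => //.
  by rewrite phi1 psi1.
- by rewrite mulr_gt0// divr_gt0.
- exact: Hp.
- exact: mg.
- exact: gM.
- exact: M_ge0.
Qed.
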